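(* Let $m\ge 3$. Then A wins the gp achievement game on $K_3\,\square\,C_m$ if and only if $m\in\{3,5\}$.
   Context: A general position set of a graph $G$ is a set $S\subseteq V(G)$ such that no three vertices of $S$ lie on a common shortest path of $G$. The gp achievement game on a graph: players A and B alternately select vertices, A first; a selection is legal if the vertex has not been selected before and the set of all vertices selected so far (including it) is a general position set. The game ends when no legal move exists, and the player who selected the last vertex wins; ''a player wins the game'' means that player has a winning strategy. The Cartesian product $G\,\square\,H$ has vertex set $V(G)\times V(H)$, with $(g_1,h_1)$ adjacent to $(g_2,h_2)$ iff either $g_1g_2\in E(G)$ and $h_1=h_2$, or $g_1=g_2$ and $h_1h_2\in E(H)$. $K_3$ is the complete graph on 3 vertices and $C_m$ the cycle on $m$ vertices. *)

(* Defs.v *)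
From mathcomp Require Import all_boot.

Set Implicit Arguments.
Unset Strict Implicit.
Unset Printing Implicit Defensive.

(* A finite simple graph is given by its symmetric irreflexive adjacency
   relation on a finType. *)

Inductive player := PlayerA | PlayerB.

Section GpGame.

Variables (T : finType) (e : rel T).

(* The vertex sequence [x :: p] is a shortest path between its two ends [x]
   and [last x p]. *)
Definition shortest_path (x : T) (p : seq T) : Prop :=
  path e x p /\
  forall q : seq T, path e x q -> last x q = last x p -> size p <= size q.

Definition on_common_shortest_path (u v w : T) : Prop :=
  exists (x : T) (p : seq T),
    shortest_path x p /\ [/\ u \in x :: p, v \in x :: p & w \in x :: p].

Definition general_position (S : {set T}) : Prop :=
  forall u v w : T, u \in S -> v \in S -> w \in S ->
    u != v -> u != w -> v != w -> ~ on_common_shortest_path u v w.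

(* A history lists the selected vertices, the oldest one first. *)
Definition legal_move (h : seq T) (v : T) : Prop :=
  v \notin h /\ general_position [set x in rcons h v].

Definition legal_history (h : seq T) : Prop :=
  forall (h1 : seq T) (v : T), prefix (rcons h1 v) h -> legal_move h1 v.

Definition finished (h : seq T) : Prop :=
  legal_history h /\ forall v : T, ~ legal_move h v.

Definition to_move (h : seq T) : player :=
  if odd (size h) then PlayerB else PlayerA.

Definition selected_last (P : player) (h : seq T) : Prop :=
  exists (h1 : seq T) (v : T), h = rcons h1 v /\ to_move h1 = P.

Definition strategy := seq T -> T.

Definition follows (P : player) (s : strategy) (h : seq T) : Prop :=
  forall (h1 : seq T) (v : T),
    prefix (rcons h1 v) h -> to_move h1 = P -> v = s h1.

(* Legality is only demanded at the histories that can occur when [P] plays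
   [s], and only when [P] has a legal move at all. *)
Definition legal_strategy (P : player) (s : strategy) : Prop :=
  forall h : seq T, legal_history h -> follows P s h -> to_move h = P ->
    (exists v : T, legal_move h v) -> legal_move h (s h).

Definition winning_strategy (P : player) (s : strategy) : Prop :=
  legal_strategy P s /\
  forall h : seq T, finished h -> follows P s h -> selected_last P h.

Definition wins_gp_achievement (P : player) : Prop :=
  exists s : strategy, winning_strategy P s.

End GpGame.

Definition cartesian_product (T U : finType) (e : rel T) (f : rel U) :
    rel (T * U) :=
  fun x y => (e x.1 y.1 && (x.2 == y.2)) || ((x.1 == y.1) && f x.2 y.2).

Definition complete_graph (n : nat) : rel 'I_n := fun i j => i != j.

(* [ordS] is the successor modulo [m]; this is the cycle C_m for 3 <= m. *)
Definition cycle_graph (m : nat) : rel 'I_m :=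
  fun i j => (j == ordS i) || (i == ordS j).

Lemma complete_graph_sym n : symmetric (@complete_graph n).
Proof. by move=> i j; rewrite /complete_graph eq_sym. Qed.

Lemma complete_graph_irr n : irreflexive (@complete_graph n).
Proof. by move=> i; rewrite /complete_graph eqxx. Qed.

Lemma cycle_graph_sym m : symmetric (@cycle_graph m).
Proof. by move=> i j; rewrite /cycle_graph orbC. Qed.

Lemma cycle_graph_irr m : 2 <= m -> irreflexive (@cycle_graph m).
Proof.
move=> m_ge2 i; rewrite /cycle_graph orbb -val_eqE /=.
have [lt_im|le_mi] := ltnP i.+1 m.
  by rewrite modn_small // ltn_eqF.
have def_m : i.+1 = m by apply/eqP; rewrite eqn_leq le_mi ltn_ord.
by rewrite def_m modnn; apply/negbTE; rewrite -lt0n -ltnS def_m.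
Qed.

Lemma cartesian_product_sym (T U : finType) (e : rel T) (f : rel U) :
  symmetric e -> symmetric f -> symmetric (cartesian_product e f).
Proof.
move=> se sf x y.
by rewrite /cartesian_product se sf [x.1 == _]eq_sym [x.2 == _]eq_sym.
Qed.

Lemma cartesian_product_irr (T U : finType) (e : rel T) (f : rel U) :
  irreflexive e -> irreflexive f -> irreflexive (cartesian_product e f).
Proof. by move=> ie jf x; rewrite /cartesian_product ie jf andbF. Qed.

(* Main.v *)
Require Import Defs.
From mathcomp Require Import all_boot zify.

(* In K_3 [] C_m the distance is [a <> b] plus the distance in C_m, and three
   vertices lie on a common shortest path iff one of the three triangle
   inequalities between them is an equality.

   If m is even, B answers every move by its antipode in the same layer; the
   selected set stays closed under antipodes, so the answer is always legal.

   If m = 2r + 1, orient C_m as a regular tournament (k beats the r positions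
   following it).  Two vertices at positions i, j of one layer and a vertex at
   position k of another layer are in general position iff k beats exactly one
   of i, j and differs from both; three vertices in distinct layers always are.
   Hence a layer with three selected vertices excludes all other vertices, and
   otherwise at most two vertices per layer are selected.  For r >= 3, B answers
   (l, a) by (l', a + 2), and then either ends the game with the fourth vertex
   or doubles a layer by one of the two positions opposite to its first vertex,
   so that every fifth vertex can be completed to two vertices in each layer.

   For m = 3 and m = 5 a game tree search shows that A wins. *)

Set Implicit Arguments.
Unset Strict Implicit.
Unset Printing Implicit Defensive.

(** * Shortest paths and the game on a graph with known distances *)

Lemma prefix_rconsE (T : eqType) (s h : seq T) (v : T) :
  prefix s (rcons h v) = prefix s h || (s == rcons h v).
Proof.
apply/idP/orP=> [/prefixP[t]|[hs|/eqP->]]; last exact: prefix_refl.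
  case/lastP: t => [|t w]; first by rewrite cats0 => ->; right.
  by rewrite -rcons_cat => /rcons_inj[-> _]; left; apply: prefix_prefix.
exact: prefix_trans hs (prefix_rcons _ _).
Qed.

Section Geodesic.

Variables (T : finType) (e : rel T) (d : T -> T -> nat).

Definition aligned (u v w : T) : bool :=
  [|| d u v + d v w == d u w, d v u + d u w == d v w | d u w + d w v == d u v].

(** Together these make [d] the graph distance: [d_edge] bounds it by the length of any path, and
    descent along [d_step] yields a path attaining it. *)
Hypothesis d_sym : forall x y, d x y = d y x.
Hypothesis d_xx : forall x, d x x = 0.
Hypothesis d_eq0 : forall x y, d x y = 0 -> x = y.
Hypothesis d_edge : forall x y z, e x z -> d x y <= (d z y).+1.
Hypothesis d_step : forall x y n, d x y = n.+1 -> exists2 z, e x z & d z y = n.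

Lemma dist_le_path x p : path e x p -> d x (last x p) <= size p.
Proof.
elim: p x => [|y p IHp] x /=; first by rewrite d_xx.
by case/andP=> exy /IHp le; apply: leq_trans (d_edge _ exy) _.
Qed.

Lemma dist_path x y :
  exists p, [/\ path e x p, last x p = y & size p = d x y].
Proof.
move Dn: (d x y) => n; elim: n x Dn => [|n IHn] x Dn.
  by exists [::]; split=> //; apply: d_eq0.
have [z exz /IHn[p [ep lp sp]]] := d_step Dn.
by exists (z :: p); split; rewrite //= ?exz ?sp.
Qed.

Lemma dist_triangle x y z : d x z <= d x y + d y z.
Proof.
have [p [ep lp <-]] := dist_path x y; have [q [eq lq <-]] := dist_path y z.
have /dist_le_path: path e x (p ++ q) by rewrite cat_path ep lp.
by rewrite last_cat lp lq size_cat.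
Qed.

(** The pieces of the path before [i], between [i] and [j], and after [j] bound three distances from
    above. By the triangle inequality these sum to at least [size p], so each bound is attained. *)
Lemma dist_shortest_path x p i j :
  shortest_path e x p -> i <= j -> j <= size p ->
  d (nth x (x :: p) i) (nth x (x :: p) j) = j - i.
Proof.
move=> [ep min_p]; set f := nth x (x :: p).
have le_d k l : l + k <= size p -> d (f l) (f (l + k)) <= k.
  elim: k l => [|k IHk] l lk; first by rewrite addn0 d_xx.
  have elk : e (f l) (f l.+1) by apply: (pathP x ep); lia.
  by apply: leq_trans (d_edge _ elk) _; rewrite -addSnnS ltnS IHk // addSnnS.
have geq_d : size p <= d (f 0) (f (size p)).
  have [q [eq lq sq]] := dist_path x (last x p).
  by rewrite [f (size p)](nth_last x (x :: p)) /= -sq min_p.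
move=> le_ij le_jp.
have := le_d i 0; have := le_d (j - i) i; have := le_d (size p - j) j.
have := dist_triangle (f 0) (f i) (f (size p)).
have := dist_triangle (f i) (f j) (f (size p)).
rewrite !subnKC // add0n; lia.
Qed.

Lemma on_common_shortest_pathP u v w :
  on_common_shortest_path e u v w <-> aligned u v w.
Proof.
split=> [[x [p [sp [pu pv pw]]]] | al].
  have D y z : y \in x :: p -> z \in x :: p ->
      d y z = maxn (index y (x :: p)) (index z (x :: p))
              - minn (index y (x :: p)) (index z (x :: p)).
    move=> py pz; rewrite -{1}(nth_index x py) -{1}(nth_index x pz).
    move: py pz; rewrite -!index_mem ltnS.
    move: (index y _) (index z _) => i j li lj.
    have [le|/ltnW le] := leqP i j; first by rewrite dist_shortest_path.
    by rewrite d_sym dist_shortest_path.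
  rewrite /aligned !D //; lia.
have btw a b c : d a b + d b c = d a c -> on_common_shortest_path e a b c.
  move=> abc.
  have [p [ep lp sp]] := dist_path a b; have [q [eq lq sq]] := dist_path b c.
  exists a, (p ++ q); split; last first.
    split; rewrite -?cat_cons mem_cat ?mem_head //.
      by rewrite -{1}lp mem_last.
    by rewrite -lq; have := mem_last b q; rewrite inE => /orP[/eqP->|->];
       rewrite ?orbT // -lp mem_last.
  split; first by rewrite cat_path ep lp.
  move=> s es; rewrite last_cat lp lq size_cat sp sq abc => <-.
  exact: dist_le_path.
case/or3P: al => /eqP /btw [x [p [sp [? ? ?]]]]; exists x, p; split=> //.
Qed.

(* In a legal history only the triples through the new vertex matter. *)
Definition legal_next (h : seq T) (v : T) : bool :=
  (v \notin h) &&
  all (fun x => all (fun y => (x != y) ==> ~~ aligned x y v) h) h.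

Lemma legal_nextP h v :
  reflect (v \notin h /\ {in h &, forall x y, x != y -> ~~ aligned x y v})
          (legal_next h v).
Proof.
apply: (iffP andP) => -[vh al]; split=> //.
  by move=> x y xh yh xy; move/allP/(_ x xh)/allP/(_ y yh): al; rewrite xy.
by apply/allP=> x xh; apply/allP=> y yh; apply/implyP; apply: al.
Qed.

Lemma alignedC12 x y z : aligned x y z = aligned y x z.
Proof. by rewrite /aligned !(d_sym _ x) (d_sym z y); lia. Qed.

Lemma alignedC23 x y z : aligned x y z = aligned x z y.
Proof. by rewrite /aligned !(d_sym _ x) (d_sym z y); lia. Qed.

Lemma legal_history_general_position h :
  legal_history e h -> general_position e [set x in h].
Proof.
case/lastP: h => [_ u v w|h v lh]; first by rewrite inE.
by case: (lh h v (prefix_refl _)).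
Qed.

Lemma legal_moveP h v :
  legal_history e h -> (legal_move e h v <-> legal_next h v).
Proof.
move=> /legal_history_general_position gp; split.
  case=> vh gpv; apply/legal_nextP; split=> // x y xh yh xy.
  apply/negP=> /on_common_shortest_pathP; apply: gpv => //;
    rewrite ?inE ?mem_rcons ?inE ?xh ?yh ?eqxx ?orbT //.
    by apply: contraNneq vh => <-.
  by apply: contraNneq vh => <-.
case/legal_nextP=> vh al; split=> // x y z.
rewrite !inE !mem_rcons !inE.
case: (eqVneq x v) => [->|_] /=; case: (eqVneq y v) => [->|_] /=;
  case: (eqVneq z v) => [->|_] //=; rewrite ?eqxx //.
- move=> _ yh zh _ _ yz /on_common_shortest_pathP.
  by rewrite alignedC12 alignedC23; apply/negP/al.
- move=> xh _ zh _ xz _ /on_common_shortest_pathP.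
  by rewrite alignedC23; apply/negP/al.
- by move=> xh yh _ xy _ _ /on_common_shortest_pathP; apply/negP/al.
- by move=> xh yh zh; apply: gp; rewrite inE.
Qed.

Lemma legal_history_nil : legal_history e [::].
Proof. by move=> h1 v; rewrite prefixs0 -size_eq0 size_rcons. Qed.

Lemma legal_history_rcons h v :
  legal_history e (rcons h v) <-> legal_history e h /\ legal_move e h v.
Proof.
split=> [lh | [lh lv] h1 w].
  split; last exact: lh (prefix_refl _).
  by move=> h1 w hw; apply: lh; rewrite prefix_rconsE hw.
by rewrite prefix_rconsE => /orP[/lh //|/eqP/rcons_inj[-> ->]].
Qed.

Lemma follows_rcons P s h v :
  follows P s (rcons h v) <-> follows P s h /\ (to_move h = P -> v = s h :> T).
Proof.
split=> [fh | [fh sv] h1 w].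
  split; last by apply: fh (prefix_refl _).
  by move=> h1 w hw; apply: fh; rewrite prefix_rconsE hw.
by rewrite prefix_rconsE => /orP[/fh //|/eqP/rcons_inj[-> ->]].
Qed.

(* [safe n h]: the player to move at [h] loses, and the opponent can force
   this within [n] further rounds. *)
Fixpoint safe (n : nat) (h : seq T) : bool :=
  [forall v, legal_next h v ==>
    (if n is n'.+1 then
       [exists w, legal_next (rcons h v) w && safe n' (rcons (rcons h v) w)]
     else false)].

Lemma safeS n h : safe n h -> safe n.+1 h.
Proof.
elim: n h => [|n IHn] h /forallP sh; apply/forallP=> v; apply/implyP=> hv;
  have := sh v; rewrite hv //= => /existsP[w /andP[hw sw]].
by apply/existsP; exists w; rewrite hw; apply: IHn.
Qed.

(** Any strategy of A is beaten by the replies that [safe] provides: at even length either A is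
    stuck and did not move last, or the game returns to a safe position of smaller depth. *)
Lemma safe_not_wins n : safe n [::] -> ~ wins_gp_achievement e PlayerA.
Proof.
move=> s0 [s [lgl win]].
suff lose h : legal_history e h -> follows PlayerA s h ->
    ~~ odd (size h) -> safe n h -> False.
  apply: (lose [::]) s0 => //; first exact: legal_history_nil.
  by move=> h1 v; rewrite prefixs0 -size_eq0 size_rcons.
elim: n h {s0} => [|n IHn] h lh fh evh /forallP sh.
all: have tA : to_move h = PlayerA by rewrite /to_move (negbTE evh).
all: have [v0 hv0] : exists v, legal_next h v.
1,3: apply/existsP; apply: contraT => /existsPn nov.
1,2: have [|h1 [v [Dh t1]]] := win h _ fh.
1,3: by split=> // v /(legal_moveP _ lh); apply/negP.
1,2: by move: evh t1; rewrite Dh size_rcons /to_move /=; case: (odd _).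
all: have hs : legal_move e h (s h)
  by apply: lgl => //; exists v0; apply/legal_moveP.
all: have := sh (s h); move/(legal_moveP _ lh): (hs) => -> //=.
case/existsP=> w /andP[hw sw].
have lh1 : legal_history e (rcons h (s h)) by apply/legal_history_rcons.
apply: IHn sw; rewrite ?size_rcons ?negbK //=.
- by apply/legal_history_rcons; split=> //; apply/legal_moveP.
apply/follows_rcons; split; first by apply/follows_rcons.
by rewrite /to_move size_rcons /= evh.
Qed.

(** A always picks some move into a safe position; [x] shows that one exists at the start, and is
    the default where none exists. *)
Lemma safe_wins n x : safe n [:: x] -> wins_gp_achievement e PlayerA.
Proof.
move=> sx.
pose good h w := legal_next h w && safe n (rcons h w).
pose s h := odflt x [pick w | good h w].
have sP h w : good h w -> good h (s h).
  by rewrite /s; case: pickP => [//|/(_ w)->].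
(* Each round lowers the depth by one and [safeS] restores it, so a single [n] serves the whole
   strategy. *)
have next h v : safe n h -> legal_next h v ->
    good (rcons h v) (s (rcons h v)).
  case: n @good @s sP {sx} => [|k] good s sP /= /forallP/(_ v); 
    move=> + hv; rewrite hv //= => /existsP[w /andP[hw sw]].
  by apply: (sP _ w); rewrite /good hw safeS.
have g0 : good [::] (s [::]) by apply: (sP _ x); rewrite /good sx.
have main h : legal_history e h -> follows PlayerA s h ->
    if odd (size h) then safe n h : Prop else good h (s h).
  elim/last_ind: h => [|h v IHh] //.
  case/legal_history_rcons=> lh lv /follows_rcons[fh sv].
  have := IHh lh fh; rewrite size_rcons /=; move: sv; rewrite /to_move.
  have := lv; move/legal_moveP => /(_ lh) hv.
  case: (odd (size h)) => /= [_ sh|->//]; first exact: next.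
  by case/andP.
exists s; split=> [h lh fh tA _ | h [lh noh] fh].
  have := main h lh fh; move: tA; rewrite /to_move.
  by case: ifP => // _ _ /andP[+ _]; move/legal_moveP; apply.
have := main h lh fh; case: ifP => [odh _|_ /andP[+ _]]; last first.
  by move/legal_moveP => /(_ lh) /noh.
case/lastP: h odh {lh noh fh} => // h v; rewrite size_rcons /= => evh.
by exists h, v; split=> //; rewrite /to_move (negbTE evh).
Qed.

(** An invariant that can be restored after every move amounts to a strategy. Histories have no
    repetitions, so depth [#|T|] suffices. *)
Lemma safe_invariant (P : seq T -> Prop) h :
  (forall s v, P s -> legal_next s v ->
    exists2 w, legal_next (rcons s v) w & P (rcons (rcons s v) w)) ->
  P h -> uniq h -> safe #|T| h.
Proof.
move=> stepP; have : #|T| <= #|T| + size h by apply: leq_addr.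
elim: {2 3}#|T| h => [|n IHn] h leT Ph uh; apply/forallP=> v; apply/implyP=> hv.
  have /legal_nextP[vh _] := hv.
  have /card_uniqP Dc : uniq (rcons h v) by rewrite rcons_uniq vh.
  by have := max_card (mem (rcons h v)); rewrite Dc size_rcons; lia.
have [w hw Pw] := stepP _ _ Ph hv.
apply/existsP; exists w; rewrite hw /=; apply: IHn => //.
  by rewrite !size_rcons; lia.
rewrite !rcons_uniq uh.
by case/legal_nextP: hv => ->; case/legal_nextP: hw => ->.
Qed.

End Geodesic.

(** * Distances in K_p [] C_m *)

(** Subtraction is truncated, so [k] is the absolute difference; the two arcs have lengths [k] and
    [m - k]. *)
Definition cycle_dist (m i j : nat) : nat :=
  let k := (i - j) + (j - i) in minn k (m - k).

Lemma cycle_dist_sym m i j : cycle_dist m i j = cycle_dist m j i.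
Proof. by rewrite /cycle_dist [_ - _ + _]addnC. Qed.

Definition prism_dist (p m : nat) (u v : 'I_p * 'I_m) : nat :=
  (u.1 != v.1) + cycle_dist m u.2 v.2.

Section Prism.

Variables (p m : nat).
Hypothesis m_gt1 : 1 < m.

Notation V := ('I_p * 'I_m)%type.
Notation prism := (cartesian_product (@complete_graph p) (@cycle_graph m)).
Notation d := (@prism_dist p m).

Lemma val_ordS (i : 'I_m) : ordS i = (if i.+1 == m then 0 else i.+1) :> nat.
Proof.
case: (eqVneq i.+1 m) => [Di|ne] /=; first by rewrite Di modnn.
by rewrite modn_small //; have := ltn_ord i; lia.
Qed.

Lemma val_ord_pred (i : 'I_m) :
  ord_pred i = (if i == 0 :> nat then m.-1 else i.-1) :> nat.
Proof.
have im := ltn_ord i; case: (eqVneq (i : nat) 0) => [Di|ne] /=.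
  by rewrite Di add0n modn_small; lia.
have -> : (i + m).-1 = i.-1 + m by lia.
by rewrite modnDr modn_small; lia.
Qed.

Lemma cycle_graphE (i j : 'I_m) :
  cycle_graph i j = (j == (if i.+1 == m then 0 else i.+1) :> nat)
                 || (i == (if j.+1 == m then 0 else j.+1) :> nat).
Proof. by rewrite /cycle_graph -!val_eqE /= -!val_ordS. Qed.

Lemma prism_dist_sym (x y : V) : d x y = d y x.
Proof. by rewrite /prism_dist eq_sym cycle_dist_sym. Qed.

Lemma prism_dist_xx (x : V) : d x x = 0.
Proof. by rewrite /prism_dist /cycle_dist eqxx subnn min0n. Qed.

Lemma prism_dist_eq0 (x y : V) : d x y = 0 -> x = y.
Proof.
case: x y => a i [b j]; rewrite /prism_dist /cycle_dist /=.
have := ltn_ord i; have := ltn_ord j.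
case: (eqVneq a b) => [->|//] /= im jm d0; congr (_, _).
by apply: val_inj => /=; lia.
Qed.

Lemma prism_dist_edge (x y z : V) : prism x z -> d x y <= (d z y).+1.
Proof.
case: x y z => a i [b j] [c k]; rewrite /cartesian_product /prism_dist /=.
case/orP=> /andP[].
  by move=> _ /eqP->; case: (a != b); case: (c != b); lia.
move=> /eqP->; rewrite cycle_graphE -addnS leq_add2l /cycle_dist.
have := ltn_ord i; have := ltn_ord j; have := ltn_ord k.
by case: (i.+1 =P m); case: (k.+1 =P m); lia.
Qed.

Lemma prism_dist_step (x y : V) n :
  d x y = n.+1 -> exists2 z, prism x z & d z y = n.
Proof.
case: x y => a i [b j]; rewrite /prism_dist /=.
case: (eqVneq a b) => [->|ab] /= Dn; last first.
  exists (b, i); rewrite /= ?eqxx; last by move: Dn; rewrite addSn => -[].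
  by rewrite /cartesian_product /= /complete_graph ab eqxx.
have im := ltn_ord i; have jm := ltn_ord j.
have [k eik Dk] : exists2 k, cycle_graph i k & cycle_dist m k j = n.
  (* Going forward is shortest when [i < j] and the arc without wraparound is a shortest one, or
     when both fail. *)
  have [fwd|bwd] :=
    boolP ((i < j) == (i - j + (j - i) <= m - (i - j + (j - i)))).
    exists (ordS i); first by rewrite /cycle_graph eqxx.
    rewrite val_ordS; move: Dn fwd; rewrite /cycle_dist.
    by case: (i.+1 =P m); lia.
  exists (ord_pred i); first by rewrite /cycle_graph ord_predK eqxx orbT.
  rewrite val_ord_pred; move: Dn bwd; rewrite /cycle_dist.
  by case: (i =P 0 :> nat); lia.
by exists (b, k); rewrite /cartesian_product /= ?eqxx ?eik ?orbT.
Qed.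

End Prism.

Lemma prism_wins (m n : nat) (x : 'I_3 * 'I_m) : 1 < m ->
  safe (@prism_dist 3 m) n [:: x] ->
  wins_gp_achievement
    (cartesian_product (@complete_graph 3) (@cycle_graph m)) PlayerA.
Proof.
move=> m_gt1; apply: safe_wins.
- exact: prism_dist_sym.
- exact: prism_dist_xx.
- exact: prism_dist_eq0.
- exact: prism_dist_edge.
- exact: prism_dist_step.
Qed.

Lemma prism_not_wins (m n : nat) : 1 < m ->
  safe (@prism_dist 3 m) n [::] ->
  ~ wins_gp_achievement
    (cartesian_product (@complete_graph 3) (@cycle_graph m)) PlayerA.
Proof.
move=> m_gt1; apply: safe_not_wins.
- exact: prism_dist_sym.
- exact: prism_dist_xx.
- exact: prism_dist_eq0.
- exact: prism_dist_edge.
- exact: prism_dist_step.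
Qed.

(** * The cases m = 3 and m = 5 *)

Section Search.

Variables (T : finType) (d : T -> T -> nat).

(** A computable form of [safe]: candidates come from a list, pruned every round because an illegal
    vertex stays illegal. *)
Fixpoint safe_on (n : nat) (vs h : seq T) : bool :=
  all (fun v =>
         if n is n'.+1 then
           let vs' := [seq w <- vs | legal_next d (rcons h v) w] in
           has (fun w => safe_on n' vs' (rcons (rcons h v) w)) vs'
         else false)
      [seq v <- vs | legal_next d h v].

Lemma legal_next_rconsW h v w : legal_next d (rcons h v) w -> legal_next d h w.
Proof.
case/legal_nextP=> wh al; apply/legal_nextP; split.
  by apply: contraNN wh; rewrite mem_rcons inE orbC => ->.
by move=> x y xh yh; apply: al; rewrite mem_rcons inE ?xh ?yh orbT.
Qed.

Lemma safe_onW n vs h :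
  {subset legal_next d h <= vs} -> safe_on n vs h -> safe d n h.
Proof.
elim: n vs h => [|n IHn] vs h vsh /allP sh; apply/forallP=> v;
  apply/implyP=> hv; have := sh v; rewrite mem_filter hv vsh // => /(_ isT) //.
case/hasP=> w; rewrite mem_filter => /andP[hw _] sw.
apply/existsP; exists w; rewrite hw; apply: IHn sw => x xh.
have xv := legal_next_rconsW xh.
by rewrite mem_filter xv vsh //; apply: legal_next_rconsW xv.
Qed.

End Search.

(* Unlike [enum 'I_n], this list can be evaluated. *)
Definition ords (n : nat) : seq 'I_n := pmap (insub_eq _) (iota 0 n).

Lemma mem_ords n (i : 'I_n) : i \in ords n.
Proof.
by rewrite /ords (eq_pmap (insub_eqE _)); apply: mem_ord_enum.
Qed.

Definition vertices (p m : nat) : seq ('I_p * 'I_m) :=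
  [seq (a, i) | a <- ords p, i <- ords m].

Lemma mem_vertices p m (v : 'I_p * 'I_m) : v \in vertices p m.
Proof.
by case: v => a i; apply/allpairsP; exists (a, i); split; rewrite //= mem_ords.
Qed.

Lemma prism_wins_3 :
  wins_gp_achievement
    (cartesian_product (@complete_graph 3) (@cycle_graph 3)) PlayerA.
Proof.
apply: (@prism_wins 3 3 (ord0, ord0)) => //.
apply: (@safe_onW _ _ _ (vertices 3 3)).
  by move=> v _; apply: mem_vertices.
by vm_compute.
Qed.

Lemma prism_wins_5 :
  wins_gp_achievement
    (cartesian_product (@complete_graph 3) (@cycle_graph 5)) PlayerA.
Proof.
apply: (@prism_wins 5 2 (ord0, ord0)) => //.
apply: (@safe_onW _ _ _ (vertices 3 5)).
  by move=> v _; apply: mem_vertices.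
by vm_compute.
Qed.

(** * Even m *)

Section Even.

Variables (m r : nat).
Hypothesis Dm : m = r + r.
Hypothesis r_gt1 : 1 < r.

Notation V := ('I_3 * 'I_m)%type.
Notation d := (@prism_dist 3 m).

Definition antipode (v : V) : V :=
  (v.1, insubd v.2 (if v.2 < r then v.2 + r else v.2 - r)).

Lemma val_antipode (v : V) :
  (antipode v).2 = (if v.2 < r then v.2 + r else v.2 - r) :> nat.
Proof.
have im := ltn_ord v.2.
by rewrite val_insubd; case: (ltnP v.2 r) => ?; case: ifP => //; lia.
Qed.

Lemma antipodeK : involutive antipode.
Proof.
move=> v; have vm := ltn_ord v.2.
have Dv : (antipode (antipode v)).2 = v.2.
  apply: ord_inj; rewrite !val_antipode.
  by case: (ltnP v.2 r) => ?; case: ifP; lia.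
by rewrite [LHS]surjective_pairing Dv; case: v {vm Dv}.
Qed.

Lemma antipode_neq v : antipode v != v.
Proof.
by apply/eqP=> Dv; have := val_antipode v; rewrite Dv; case: ifP; lia.
Qed.

Lemma prism_dist_antipode u v : d (antipode u) (antipode v) = d u v.
Proof.
rewrite /prism_dist /cycle_dist !val_antipode /=; congr (_ + _).
have := ltn_ord u.2; have := ltn_ord v.2.
by case: (ltnP u.2 r); case: (ltnP v.2 r); lia.
Qed.

(** Both arcs between antipodes have length [r], so every position lies on a shortest path between
    them. *)
Lemma cycle_dist_antipode (u v : V) :
  cycle_dist m u.2 (antipode v).2 + cycle_dist m u.2 v.2 = r.
Proof.
rewrite /cycle_dist val_antipode.
have := ltn_ord u.2; have := ltn_ord v.2.
by case: (ltnP v.2 r); lia.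
Qed.

(** Within one layer the conclusion always holds, by [cycle_dist_antipode]. In different layers
    premise and conclusion both say that the positions of [x] and [v] are at distance 0 or [r]. *)
Lemma aligned_antipode x v :
  aligned d v (antipode x) x -> aligned d v (antipode v) x.
Proof.
have c0 u : cycle_dist m u u = 0 by rewrite /cycle_dist subnn min0n.
have := cycle_dist_antipode v x; have := cycle_dist_antipode x v.
have := cycle_dist_antipode x x; have := cycle_dist_antipode v v.
rewrite /aligned /prism_dist !(cycle_dist_sym _ (antipode _).2).
rewrite (cycle_dist_sym _ x.2 v.2) !c0.
move: (cycle_dist m v.2 (antipode v).2) (cycle_dist m v.2 (antipode x).2).
move: (cycle_dist m x.2 (antipode v).2) (cycle_dist m x.2 (antipode x).2).
move: (cycle_dist m v.2 x.2) => D D1 D2 D3 D4; rewrite /= !(eq_sym x.1) !eqxx.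
by case: (v.1 == x.1) => /=; lia.
Qed.

Lemma prism_even_safe : safe d #|{: V}| [::].
Proof.
apply: (safe_invariant (P := fun h => {in h, forall v, antipode v \in h}));
  rewrite //.
move=> h x clh /legal_nextP[xh alh]; exists (antipode x); last first.
  move=> v; rewrite !(mem_rcons, inE) => /or3P[/eqP->|/eqP->|/clh->].
  - by rewrite antipodeK eqxx orbT.
  - by rewrite eqxx.
  - by rewrite !orbT.
(* A conflict of the reply with [x] and an old [v] would make [x] conflict with [v] and its
   antipode, both selected earlier. *)
have alx v : v \in h -> ~~ aligned d v (antipode x) x.
  move=> vh; apply: contraNN (alh v _ vh (clh v vh) _).
    exact: aligned_antipode.
  by rewrite eq_sym antipode_neq.
apply/legal_nextP; split.
  rewrite mem_rcons inE negb_or antipode_neq; apply: contraNN xh => /clh.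
  by rewrite antipodeK.
move=> u v; rewrite !mem_rcons !inE.
have C12 := alignedC12 (@prism_dist_sym 3 m).
have C23 := alignedC23 (@prism_dist_sym 3 m).
case/predU1P=> [->|uh] /predU1P[->|vh]; rewrite ?eqxx // => uv.
- by rewrite C12 C23 alx.
- by rewrite C23 alx.
(* The antipodal map is an isometry, so a conflict of the reply with [u] and [v] is one of [x] with
   their antipodes. *)
have := alh _ _ (clh u uh) (clh v vh); rewrite (can_eq antipodeK) => /(_ uv).
by rewrite -{1}[x]antipodeK /aligned !prism_dist_antipode.
Qed.

End Even.

(** * Odd m *)

Section Odd.

Variables (m r : nat).
Hypothesis Dm : m = (r + r).+1.

Notation V := ('I_3 * 'I_m)%type.
Notation d := (@prism_dist 3 m).

Implicit Types (i j k x y z a b c : 'I_m) (l la lb lc : 'I_3) (h : seq V).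

(** * Half-circles and diameters of an odd cycle *)

(* [i - k] is between [1] and [r] modulo [m]. *)
Definition beats k i : bool := (k < i <= k + r) || (i + r < k).

(** [beats k] is the half-circle following [k], so this says that the diameter through [k] separates
    [i] and [j]. *)
Definition splits k i j : bool := [&& k != i, k != j & beats k i != beats k j].

(* [y] is one of the two positions [x + r], [x + r + 1] modulo [m]. *)
Definition far x y : bool :=
  (y == x + r :> nat) || (y == (x + r).+1 :> nat)
  || (x == y + r :> nat) || (x == (y + r).+1 :> nat).

Lemma splits_sym k i j : splits k i j = splits k j i.
Proof. by rewrite /splits andbCA [beats k i == _]eq_sym. Qed.

Lemma splits_ntrans k x y z : splits k x y -> splits k y z -> ~~ splits k x z.
Proof.
case/and3P=> _ _ + /and3P[_ _ +]; rewrite /splits.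
by case: (beats k x) (beats k y) (beats k z) => [] [] []; rewrite ?andbF.
Qed.

Lemma far_neq x y : 0 < r -> far x y -> x != y.
Proof. by rewrite /far -val_eqE /=; lia. Qed.

(** The arcs between [x] and [y] have lengths [r] and [r + 1]; inside either, [z] is within [r] of
    both ends, one ahead and one behind. *)
Lemma far_splits x y z : far x y -> z != x -> z != y -> splits z x y.
Proof.
rewrite /far /splits /beats -!val_eqE /=.
have := ltn_ord x; have := ltn_ord y; have := ltn_ord z; lia.
Qed.

(** Away from [x] and [y], the half-circles following [x] and [y] are complementary. *)
Lemma splits_far x y u v :
  far x y -> splits x u v -> y != u -> y != v -> splits y u v.
Proof.
rewrite /far /splits /beats -!val_eqE /=.
have := ltn_ord x; have := ltn_ord y; have := ltn_ord u; have := ltn_ord v; lia.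
Qed.

Lemma ex_far2 x : 0 < r -> exists y z, [/\ far x y, far x z & y != z].
Proof.
move=> r_gt0; have xm := ltn_ord x.
have y_lt : (if x < r then x + r else if x == r :> nat then 0 else x - r) < m.
  by case: ifP => ?; [|case: ifP => ?]; lia.
have z_lt : (if x <= r then if x == r :> nat then x + r else (x + r).+1
             else x - r.+1) < m.
  by case: ifP => ?; [case: ifP => ?|]; lia.
exists (Ordinal y_lt), (Ordinal z_lt); rewrite /far -val_eqE /=.
by case: (ltngtP x r) => ?; split; lia.
Qed.

(* [y] and [z] are then adjacent, and only the diameter through [x] passes
   between them. *)
Lemma splits_far2 x y z k : far x y -> far x z -> splits k y z -> k = x.
Proof.
rewrite /far /splits /beats -!val_eqE /= => xy xz kyz; apply: ord_inj.
have := ltn_ord x; have := ltn_ord y; have := ltn_ord z; have := ltn_ord k; lia.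
Qed.

(** The five relative positions determine [cycle_dist], [beats] and equality at once, which reduces
    later claims to linear arithmetic. *)
Variant position_spec k i : nat -> bool -> bool -> Prop :=
  | SamePosition of k = i :> nat : position_spec k i 0 false true
  | ShortAhead of k < i <= k + r : position_spec k i (i - k) true false
  | LongAhead of k + r < i : position_spec k i (m - (i - k)) false false
  | ShortBehind of i < k <= i + r : position_spec k i (k - i) false false
  | LongBehind of i + r < k : position_spec k i (m - (k - i)) true false.

Lemma positionP k i : position_spec k i (cycle_dist m k i) (beats k i) (k == i).
Proof.
have km := ltn_ord k; have im := ltn_ord i.
have [lt_ki|lt_ik|eq_ki] := ltngtP k i.
- have [le|gt] := leqP i (k + r).
    have -> : cycle_dist m k i = i - k by rewrite /cycle_dist; lia.
    have -> : beats k i by rewrite /beats; lia.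
    have -> : (k == i) = false by rewrite -val_eqE /=; lia.
    by constructor; rewrite lt_ki.
  have -> : cycle_dist m k i = m - (i - k) by rewrite /cycle_dist; lia.
  have -> : beats k i = false by rewrite /beats; lia.
  have -> : (k == i) = false by rewrite -val_eqE /=; lia.
  exact: LongAhead.
- have [le|gt] := leqP k (i + r).
    have -> : cycle_dist m k i = k - i by rewrite /cycle_dist; lia.
    have -> : beats k i = false by rewrite /beats; lia.
    have -> : (k == i) = false by rewrite -val_eqE /=; lia.
    by constructor; rewrite lt_ik.
  have -> : cycle_dist m k i = m - (k - i) by rewrite /cycle_dist; lia.
  have -> : beats k i by rewrite /beats; lia.
  have -> : (k == i) = false by rewrite -val_eqE /=; lia.
  exact: LongBehind.
have -> : cycle_dist m k i = 0 by rewrite /cycle_dist; lia.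
have -> : beats k i = false by rewrite /beats; lia.
have -> : (k == i) by rewrite -val_eqE /=; lia.
exact: SamePosition.
Qed.

(** Changing layer costs one, so [w] is never in the middle. Alignment then means that the position
    of [u] or [v] is on a shortest path from the other one to that of [w]: same side, or coincident
    with [w]. *)
Lemma alignedE (u v w : V) :
  u.1 = v.1 -> u != v -> w.1 != u.1 ->
  ~~ aligned d u v w = splits w.2 u.2 v.2.
Proof.
case: u v w => [a i] [_ j] [b k] /= <-; rewrite xpair_eqE eqxx /= => ij ba.
rewrite /aligned /prism_dist /= !(eq_sym a b) (negbTE ba) eqxx /=.
rewrite !(cycle_dist_sym _ _ k) (cycle_dist_sym _ j i) /splits.
have := ltn_ord i; have := ltn_ord j; have := ltn_ord k.
move: ij; case: (positionP i j) => //= ? _;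
  case: (positionP k i) => ?; case: (positionP k j) => ? /=; lia.
Qed.

(** All three distances contain an extra one for the change of layer, which makes the triangle
    inequalities strict. *)
Lemma aligned_rainbow (u v w : V) :
  u.1 != v.1 -> u.1 != w.1 -> v.1 != w.1 -> ~~ aligned d u v w.
Proof.
move=> uv uw vw; rewrite /aligned /prism_dist !(eq_sym v.1 u.1) !(eq_sym w.1).
rewrite uv uw vw (cycle_dist_sym _ v.2 u.2) !(cycle_dist_sym _ w.2).
have := ltn_ord u.2; have := ltn_ord v.2; have := ltn_ord w.2.
case: (positionP u.2 v.2) => ?; case: (positionP u.2 w.2) => ?;
  case: (positionP v.2 w.2) => ? /=; lia.
Qed.

Lemma legal_next_layer h l x y l' z :
  legal_next d h (l, x) -> (l, y) \in h -> (l', z) \in h -> l' != l ->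
  splits z x y.
Proof.
case/legal_nextP=> xh al yh zh ne.
have xy : (l, x) != (l, y) by apply: contraNneq xh => ->.
rewrite -(@alignedE (l, x) (l, y) (l', z)) //.
rewrite (alignedC12 (@prism_dist_sym 3 m)).
rewrite (alignedC23 (@prism_dist_sym 3 m)) al //.
by rewrite xpair_eqE eq_sym (negbTE ne).
Qed.

Lemma legal_next_across h l x l' y z :
  legal_next d h (l, x) -> (l', y) \in h -> (l', z) \in h -> l' != l ->
  y != z -> splits x y z.
Proof.
case/legal_nextP=> _ al yh zh ne yz.
have yz' : (l', y) != (l', z) by rewrite xpair_eqE eqxx.
by rewrite -(@alignedE (l', y) (l', z) (l, x)) //= 1?eq_sym // al.
Qed.

(** Triples in three layers are never aligned, and the second hypothesis excludes triples inside [l]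
    through the new vertex; the last two cover mixed triples via [alignedE]. *)
Lemma legal_next_intro h l x :
  (l, x) \notin h ->
  (forall y y', (l, y) \in h -> (l, y') \in h -> y = y') ->
  (forall y l' z, (l, y) \in h -> (l', z) \in h -> l' != l -> splits z x y) ->
  (forall l' y z, (l', y) \in h -> (l', z) \in h -> l' != l -> y != z ->
     splits x y z) ->
  legal_next d h (l, x).
Proof.
move=> xh uniq_l layer across; apply/legal_nextP; split=> //.
move=> [l1 y] [l2 z] yh zh ne.
have C12 := alignedC12 (@prism_dist_sym 3 m).
have C23 := alignedC23 (@prism_dist_sym 3 m).
have neq_x u : u \in h -> u != (l, x) by move=> uh; apply: contraNneq xh => <-.
have [D1|n1] := eqVneq l1 l; have [D2|n2] := eqVneq l2 l.
- by move: ne; rewrite D1 D2 in yh zh *; rewrite (uniq_l y z) // eqxx.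
- rewrite C23 alignedE ?neq_x //=; last by rewrite D1.
  by rewrite splits_sym; apply: layer zh n2; rewrite -D1.
- rewrite C12 C23 alignedE ?neq_x //=; last by rewrite D2.
  by rewrite splits_sym; apply: layer yh n1; rewrite -D2.
have [D12|n12] := eqVneq l1 l2; last exact: aligned_rainbow.
rewrite alignedE //=; last by rewrite eq_sym.
rewrite D12 in yh; apply: across yh zh n2 _.
by move: ne; rewrite D12 xpair_eqE eqxx.
Qed.

(** A third vertex in the layer would force the diameter through [z] to separate three positions
    pairwise. *)
Lemma full_layer h l x y y' l' z :
  (l, y) \in h -> (l, y') \in h -> (l', z) \in h -> l' != l ->
  splits z y y' -> ~~ legal_next d h (l, x).
Proof.
move=> yh y'h zh ne syy'; apply/negP=> lx.
have sxy := legal_next_layer lx yh zh ne.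
have sxy' := legal_next_layer lx y'h zh ne.
by have := splits_ntrans sxy syy'; rewrite sxy'.
Qed.

(** A new vertex in [l] would have to be separated from [y] by the diameter through [y] itself. *)
Lemma blocked_layer h l x y l' :
  (l, y) \in h -> (l', y) \in h -> l' != l -> ~~ legal_next d h (l, x).
Proof.
move=> yh y'h ne; apply/negP=> lx.
by have := legal_next_layer lx yh y'h ne; rewrite /splits eqxx andbF.
Qed.

Lemma layer_cases la lb lc l :
  la != lb -> la != lc -> lb != lc -> [|| l == la, l == lb | l == lc].
Proof.
rewrite -!val_eqE /=; have := ltn_ord l; have := ltn_ord la.
have := ltn_ord lb; have := ltn_ord lc; lia.
Qed.

Lemma safe0_layers h la lb lc :
  la != lb -> la != lc -> lb != lc ->
  (forall x, ~~ legal_next d h (la, x)) ->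
  (forall x, ~~ legal_next d h (lb, x)) ->
  (forall x, ~~ legal_next d h (lc, x)) -> safe d 0 h.
Proof.
move=> ab ac bc na nb nc; apply/forallP=> -[l x]; rewrite implybF.
by case/or3P: (layer_cases l ab ac bc) => /eqP->.
Qed.

(** * Replies that end the game *)

Section Position.

Variables la lb lc : 'I_3.
Hypotheses (ab : la != lb) (ac : la != lc) (bc : lb != lc).

Let ba : lb != la. Proof. by rewrite eq_sym. Qed.
Let ca : lc != la. Proof. by rewrite eq_sym. Qed.
Let cb : lc != lb. Proof. by rewrite eq_sym. Qed.
Let neqE := (negbTE ab, negbTE ac, negbTE bc, negbTE ba, negbTE ca, negbTE cb).

(** B doubles layer [lc] by some [c'] far from [c]; each layer then holds two positions separated by
    a vertex of another layer, so [full_layer] applies to all three. *)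
Lemma four_reply h a b b' c x :
  0 < r ->
  h =i [:: (lb, b); (lb, b'); (la, a); (lc, c)] ->
  splits a b b' -> splits c b b' -> ~~ far c b -> ~~ far c b' ->
  legal_next d h (la, x) ->
  exists w, legal_next d (rcons h (la, x)) w
         && safe d 0 (rcons (rcons h (la, x)) w).
Proof.
move=> r_gt0 Dh sa sc fb fb' lx.
have bb' : b != b' by apply: contraTneq sa => ->; rewrite /splits eqxx !andbF.
have sbx : splits b x a
  by apply: legal_next_layer lx _ _ ba; rewrite Dh !inE eqxx ?orbT.
have scx : splits c x a
  by apply: legal_next_layer lx _ _ ca; rewrite Dh !inE eqxx ?orbT.
have sxb : splits x b b'
  by apply: legal_next_across lx _ _ ba bb'; rewrite Dh !inE eqxx ?orbT.
have [c' fc' /and4P[c'a c'x c'b c'b']] :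
    exists2 c', far c c' & [&& c' != a, c' != x, c' != b & c' != b'].
  have nfb y : far c y -> (y != b) && (y != b').
    by move=> fy; apply/andP; split; apply: contraTneq fy => ->.
  have [y [z [fy fz yz]]] := ex_far2 c r_gt0.
  have [/andP[ya yx]|nya] := boolP ((y != a) && (y != x)).
    by exists y; rewrite // ya yx nfb.
  have [/andP[za zx]|nza] := boolP ((z != a) && (z != x)).
    by exists z; rewrite // za zx nfb.
  (* Both far positions are taken, by [a] and [x], which [b] separates; this forces [b = c] and
     contradicts [sc]. *)
  have syz : splits b y z.
    move: nya nza yz sbx; rewrite !negb_and !negbK.
    by case/orP=> /eqP-> /orP[]/eqP->; rewrite ?eqxx // splits_sym.
  by move: sc; rewrite (splits_far2 fy fz syz) /splits eqxx.
have c_ne z : z \in [:: a; x; b; b'] -> z != c.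
  rewrite !inE => /or4P[]/eqP->; rewrite eq_sym.
  - by case/and3P: scx.
  - by case/and3P: scx.
  - by case/and3P: sc.
  - by case/and3P: sc.
have cc' z : z \in [:: a; x; b; b'] -> splits z c c'.
  move=> zs; apply: (far_splits fc'); first exact: c_ne.
  by move: zs; rewrite eq_sym !inE => /or4P[]/eqP->.
exists (lc, c'); apply/andP; split.
  apply: legal_next_intro.
  - rewrite mem_rcons inE Dh !inE !xpair_eqE !neqE eqxx /=.
    by rewrite eq_sym; apply: far_neq fc'.
  - move=> y y'; rewrite !mem_rcons !inE !Dh !inE !xpair_eqE !neqE eqxx /=.
    by move=> /eqP-> /eqP->.
  - move=> y l' z; rewrite !mem_rcons !inE !Dh !inE !xpair_eqE !neqE eqxx /=.
    move=> /eqP-> + nl; rewrite splits_sym => zs; apply: cc'; move: zs.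
    by rewrite !inE (negbTE nl); do 4?case: (z == _); rewrite ?andbF ?orbT.
  move=> l' y z + + nl; have [->|n] := eqVneq l' la.
    rewrite !mem_rcons !inE !Dh !inE !xpair_eqE !neqE eqxx /= !orbF.
    have sc'x : splits c' x a by apply: (splits_far fc').
    by case/orP=> /eqP-> /orP[]/eqP->; rewrite ?eqxx // splits_sym.
  have -> : l' = lb.
    by case/or3P: (layer_cases l' ab ac bc) n nl => /eqP->; rewrite ?eqxx.
  rewrite !mem_rcons !inE !Dh !inE !xpair_eqE !neqE eqxx /= !orbF.
  have sc'b : splits c' b b' by apply: (splits_far fc').
  by case/orP=> /eqP-> /orP[]/eqP->; rewrite ?eqxx // splits_sym.
apply: (safe0_layers ab ac bc) => y.
- by apply: (full_layer _ _ _ _ ba sbx);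
     rewrite !(mem_rcons, inE) ?Dh !inE eqxx ?orbT.
- by apply: (full_layer _ _ _ _ ab sa);
     rewrite !(mem_rcons, inE) ?Dh !inE eqxx ?orbT.
apply: (full_layer _ _ _ _ bc (cc' b _));
  by rewrite !(mem_rcons, inE) ?Dh ?inE eqxx ?orbT.
Qed.

(** Copying [b] into the third layer blocks [lb] and [lc], while [b] separates [x] and [a] and so
    fills [la]. *)
Lemma same_layer_reply h a b x :
  h =i [:: (la, a); (lb, b)] -> legal_next d h (la, x) ->
  exists w, legal_next d (rcons h (la, x)) w
         && safe d 0 (rcons (rcons h (la, x)) w).
Proof.
move=> Dh lx.
have sbx : splits b x a
  by apply: legal_next_layer lx _ _ ba; rewrite Dh !inE eqxx ?orbT.
exists (lc, b); apply/andP; split.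
  apply: legal_next_intro.
  - by rewrite mem_rcons inE Dh !inE !xpair_eqE !neqE.
  - by move=> y y'; rewrite mem_rcons inE Dh !inE !xpair_eqE !neqE.
  - by move=> y l' z; rewrite mem_rcons inE Dh !inE !xpair_eqE !neqE.
  move=> l' y z + + nl; have [->|n] := eqVneq l' la.
    rewrite !mem_rcons !inE !Dh !inE !xpair_eqE !neqE eqxx /= !orbF.
    by case/orP=> /eqP-> /orP[]/eqP->; rewrite ?eqxx // splits_sym.
  rewrite !mem_rcons !inE !Dh !inE !xpair_eqE (negbTE n) /=.
  by move=> /andP[_ /eqP->] /andP[_ /eqP->]; rewrite eqxx.
apply: (safe0_layers ab ac bc) => y.
- by apply: (full_layer _ _ _ _ ba sbx);
     rewrite !(mem_rcons, inE) ?Dh !inE eqxx ?orbT.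
- by apply: (@blocked_layer _ _ _ b lc);
     rewrite // !(mem_rcons, inE) ?Dh ?inE eqxx ?orbT.
- by apply: (@blocked_layer _ _ _ b lb);
     rewrite // !(mem_rcons, inE) ?Dh ?inE eqxx ?orbT.
Qed.

Lemma legal_next_far h b b' (a c : 'I_m) :
  0 < r -> h =i [:: (la, a); (lb, b); (lc, c)] -> far b b' ->
  a != b -> a != b' -> c != b -> c != b' -> legal_next d h (lb, b').
Proof.
move=> r_gt0 Dh fb ab1 ab2 cb1 cb2; apply: legal_next_intro.
- rewrite Dh !inE !xpair_eqE !neqE eqxx /= orbF.
  by rewrite eq_sym; apply: far_neq fb.
- move=> y y'; rewrite !Dh !inE !xpair_eqE !neqE eqxx /= !orbF.
  by move=> /eqP-> /eqP->.
- move=> y l' z; rewrite !Dh !inE !xpair_eqE !neqE eqxx /= !orbF => /eqP->.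
  move=> + nl; rewrite (negbTE nl) /= splits_sym.
  by case/orP=> /andP[_ /eqP->]; apply: (far_splits fb).
move=> l' y z; rewrite !Dh !inE !xpair_eqE => + + nl; rewrite (negbTE nl) /=.
by case/orP=> /andP[/eqP-> /eqP->]; rewrite !neqE eqxx /= ?orbF => /eqP->;
   rewrite eqxx.
Qed.

(** Position [a] occurs in [la] and [lc], which blocks both; doubling [lb] by a far position other
    than [a] fills the last layer. *)
Lemma third_layer_reply h a b :
  0 < r -> h =i [:: (la, a); (lb, b)] -> a != b ->
  exists w, legal_next d (rcons h (lc, a)) w
         && safe d 0 (rcons (rcons h (lc, a)) w).
Proof.
move=> r_gt0 Dh nab.
have [b' fb ab'] : exists2 b', far b b' & a != b'.
  have [y [z [fy fz yz]]] := ex_far2 b r_gt0.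
  by have [Da|ay] := eqVneq a y; [exists z; rewrite // Da | exists y].
have sa : splits a b b' by apply: (far_splits fb).
exists (lb, b'); apply/andP; split.
  apply: (@legal_next_far _ b b' a a) => // u.
  by rewrite mem_rcons !inE Dh !inE; do 3!case: (u == _).
apply: (safe0_layers ab ac bc) => y.
- by apply: (@blocked_layer _ _ _ a lc);
     rewrite // !(mem_rcons, inE) ?Dh ?inE eqxx ?orbT.
- by apply: (full_layer _ _ _ _ ab sa);
     rewrite !(mem_rcons, inE) ?Dh !inE eqxx ?orbT.
- by apply: (@blocked_layer _ _ _ a la);
     rewrite // !(mem_rcons, inE) ?Dh ?inE eqxx ?orbT.
Qed.

End Position.

(** Layer [lb] is full for A; the other two play symmetric roles and are answered by
    [four_reply]. *)
Lemma four_safe la lb lc h a b b' c :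
  la != lb -> la != lc -> lb != lc -> 0 < r ->
  h =i [:: (lb, b); (lb, b'); (la, a); (lc, c)] ->
  splits a b b' -> splits c b b' ->
  ~~ far a b -> ~~ far a b' -> ~~ far c b -> ~~ far c b' ->
  safe d 1 h.
Proof.
move=> ab ac bc r_gt0 Dh sa sc fab fab' fcb fcb'.
apply/forallP=> -[l x]; apply/implyP=> lx; apply/existsP.
case/or3P: (layer_cases l ab ac bc) lx => /eqP-> lx.
- exact: four_reply Dh sa sc fcb fcb' lx.
- suff /negP[] : ~~ legal_next d h (lb, x) by [].
  by apply: (full_layer _ _ _ _ ab sa); rewrite Dh !inE eqxx ?orbT.
apply: (@four_reply lc lb la) sc sa fab fab' lx; rewrite // 1?eq_sym // => u.
by rewrite Dh !inE; do 2!congr (_ || _); rewrite orbC.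
Qed.

(** * Strategy of B for [r >= 3] *)

Hypothesis r_gt2 : 2 < r.

Let r_gt0 : 0 < r. Proof. by apply: leq_trans r_gt2. Qed.

(** Supplies a doubling of [b] or of [a] that meets the hypotheses of [four_safe]; as [r >= 3],
    positions at distance 2 are not far. *)
Lemma ex_far_reply a b c :
  b = a + 2 :> nat \/ b + m = a + 2 :> nat -> c != a -> c != b ->
  (exists b', [/\ far b b', a != b', c != b' &
     [&& ~~ far a b, ~~ far a b', ~~ far c b & ~~ far c b']]) \/
  (exists a', [/\ far a a', b != a', c != a' &
     [&& ~~ far b a, ~~ far b a', ~~ far c a & ~~ far c a']]).
Proof.
have am := ltn_ord a; have bm := ltn_ord b; have cm := ltn_ord c.
have ord n : n < m -> exists y, y = n :> nat by move=> lt; exists (Ordinal lt).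
have ex_y x : exists y, y = x + r :> nat \/ y + m = x + r.
  have xm := ltn_ord x; have [lt|ge] := ltnP (x + r) m.
    by have [y Dy] := ord _ lt; exists y; left.
  by have [|y Dy] := ord (x + r - m); [lia | exists y; right; lia].
have ex_z x : exists y, y = (x + r).+1 :> nat \/ y + m = (x + r).+1.
  have xm := ltn_ord x; have [lt|ge] := ltnP (x + r).+1 m.
    by have [y Dy] := ord _ lt; exists y; left.
  by have [|y Dy] := ord ((x + r).+1 - m); [lia | exists y; right; lia].
rewrite -!val_eqE /= => Db ca cb.
have [fcb|nfcb] := boolP (far c b).
  (* Here [c] is [a + r + 2] or [a + r + 3] modulo [m], so [a] is doubled instead, by
     [a + r + 1]. *)
  have [a' Da'] := ex_z a; have := ltn_ord a'; right; exists a'.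
  move: fcb; rewrite /far -!val_eqE /=; split; lia.
(* Position [b + r] is far from [b - 1] too, so [c = b - 1] calls for [b + r + 1]. *)
left; have [Dc|nDc] := boolP ((b == c.+1 :> nat) || (b + m == c.+1)).
  have [b' Db'] := ex_z b; have := ltn_ord b'; exists b'.
  move: nfcb; rewrite /far -!val_eqE /=; split; lia.
have [b' Db'] := ex_y b; have := ltn_ord b'; exists b'.
move: nfcb; rewrite /far -!val_eqE /=; split; lia.
Qed.

(** If A's second move repeats a layer or a position, B ends the game at once; otherwise
    [ex_far_reply] leads to [four_safe]. *)
Lemma two_safe la lb h a b :
  la != lb -> b = a + 2 :> nat \/ b + m = a + 2 :> nat ->
  h =i [:: (la, a); (lb, b)] -> safe d 2 h.
Proof.
move=> ab Db Dh.
have nab : a != b by rewrite -val_eqE /=; lia.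
have Dh' : h =i [:: (lb, b); (la, a)] by move=> u; rewrite Dh !inE orbC.
have ba : lb != la by rewrite eq_sym.
have nba : b != a by rewrite eq_sym.
have [lc ac bc] : exists2 lc, la != lc & lb != lc.
  have /card_gt0P[lc] : 0 < #|~: [set la; lb]|.
    by have := cardsC [set la; lb]; rewrite cards2 card_ord ab; lia.
  by rewrite !inE negb_or => /andP[ca cb]; exists lc; rewrite eq_sym.
have W h1 : (exists w, legal_next d h1 w && safe d 0 (rcons h1 w)) ->
    exists w, legal_next d h1 w && safe d 1 (rcons h1 w).
  by case=> w /andP[lw sw]; exists w; rewrite lw; apply: safeS.
apply/forallP=> -[l c]; apply/implyP=> lx; apply/existsP.
case/or3P: (layer_cases l ab ac bc) lx => /eqP-> lx.
- exact/W/(same_layer_reply ab ac bc Dh lx).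
- exact/W/(same_layer_reply ba bc ac Dh' lx).
have [->|ca] := eqVneq c a; first exact/W/(third_layer_reply ab ac bc).
have [->|cb] := eqVneq c b; first exact/W/(third_layer_reply ba bc ac).
case: (ex_far_reply Db ca cb) => [[b' [fb ab' cb' /and4P[f1 f2 f3 f4]]]|
    [a' [fa ba' ca' /and4P[f1 f2 f3 f4]]]].
- exists (lb, b'); apply/andP; split.
    apply: (@legal_next_far la lb lc _ _ _ _ b b' a c) => // u.
    by rewrite mem_rcons !inE Dh !inE; do 3!case: (u == _).
  apply: (@four_safe la lb lc _ a b b' c) => // [u||].
  - rewrite !(mem_rcons, inE) Dh !inE; do 4!case: (u == _) => //.
  - exact: (far_splits fb).
  - exact: (far_splits fb).
exists (la, a'); apply/andP; split.
  apply: (@legal_next_far lb la lc _ _ _ _ a a' b c) => // u.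
  by rewrite mem_rcons !inE Dh' !inE; do 3!case: (u == _).
apply: (@four_safe lb la lc _ b a a' c) => // [u||].
- rewrite !(mem_rcons, inE) Dh !inE; do 4!case: (u == _) => //.
- exact: (far_splits fa).
- exact: (far_splits fa).
Qed.

Lemma prism_odd_safe : safe d 3 [::].
Proof.
apply/forallP=> -[la a]; apply/implyP=> _; apply/existsP.
have am := ltn_ord a.
have [b Db] : exists b, b = a + 2 :> nat \/ b + m = a + 2 :> nat.
  have [lt|ge] := ltnP (a + 2) m; first by exists (Ordinal lt); left.
  have lt : a + 2 - m < m by lia.
  by exists (Ordinal lt); right => /=; lia.
have [lb ab] : exists lb, la != lb.
  have /card_gt0P[lb] : 0 < #|~: [set la]|.
    by have := cardsC [set la]; rewrite cards1 card_ord; lia.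
  by rewrite !inE => ba; exists lb; rewrite eq_sym.
exists (lb, b); apply/andP; split.
  by apply: legal_next_intro => /= [|y y'|y l' z|l' y z];
     rewrite !inE !xpair_eqE ?(eq_sym lb) ?(negbTE ab) //;
     move=> /andP[_ /eqP->] /andP[_ /eqP->]; rewrite eqxx.
exact: two_safe ab Db (fun u => erefl).
Qed.

End Odd.

Theorem theorem3p8 (m : nat) (hm : 3 <= m) :
  wins_gp_achievement
    (cartesian_product (@complete_graph 3) (@cycle_graph m)) PlayerA
  <-> (m = 3 \/ m = 5).
Proof.
have m_gt1 : 1 < m by apply: leq_trans hm.
split=> [winA | [->|->]]; [|exact: prism_wins_3|exact: prism_wins_5].
have [m_odd|m_even] := boolP (odd m).
  have Dm : m = (m./2 + m./2).+1 by lia.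
  have [r_gt2|r_le2] := ltnP 2 m./2; last by lia.
  by case: (prism_not_wins m_gt1 (prism_odd_safe Dm r_gt2)).
have Dm : m = m./2 + m./2 by lia.
have r_gt1 : 1 < m./2 by lia.
by case: (prism_not_wins m_gt1 (prism_even_safe Dm r_gt1)).
Qed.
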